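(* Let $n\ge 2$. The derivative map $D:R\mathcal{C}_n\to Q\mathcal{C}_{n-1}$, $P(X)\mapsto P'(X)$, is a locally trivial fibration with fiber $\mathbb{C}\setminus(n-1)$ (the complex plane minus $n-1$ distinct points). This fibration has a (continuous) section $I: Q\mathcal{C}_{n-1}\to R\mathcal{C}_n$.
   Context: $\mathcal{F}_n=\{(z_1,\dots,z_n)\in\mathbb{C}^n\mid z_i\ne z_j \text{ for } i\neq j\}$ and $\mathcal{C}_n=\mathcal{F}_n/\Sigma_n$ is the unordered configuration space, identified with the space of monic complex polynomials of degree $n$ with non-zero discriminant (via their roots). A degree $n-1$ polynomial $Q(X)=n\prod_{k=1}^{n-1}(X-\beta_k)$ with distinct roots is identified with the point $\{\beta_1,\dots,\beta_{n-1}\}$ of $\mathcal{C}_{n-1}$. The restricted base configuration space is $$Q\mathcal{C}_{n-1}=\Big\{Q(X)=n\prod_{k=1}^{n-1}(X-\beta_k)\ \Big|\ \beta_k\neq\beta_j,\ \int_{\beta_k}^{\beta_j}Q(t)\,dt\neq 0\ \text{for all } k\neq j\Big\}\subset\mathcal{C}_{n-1}.$$ The restricted configuration space is $$R\mathcal{C}_n=\Big\{P(X)=\int_0^XQ(t)\,dt-\gamma\ \Big|\ Q(X)=n\prod_{k=1}^{n-1}(X-\beta_k)\in Q\mathcal{C}_{n-1},\ \gamma\in\mathbb{C},\ \gamma\neq\int_0^{\beta_k}Q(t)\,dt\ \text{for all }k\Big\}\subset\mathcal{C}_n .$$ Both carry the subspace topology. *)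

(* Defs.v *)
From HB Require Import structures.
From mathcomp Require Import all_boot all_order all_algebra perm.
From mathcomp Require Import generic_quotient complex ring.
From mathcomp Require Import all_classical all_reals all_analysis.

Set Implicit Arguments.
Unset Strict Implicit.
Unset Printing Implicit Defensive.

Import Order.TTheory GRing.Theory Num.Theory.
Import numFieldNormedType.Exports.

Local Open Scope classical_set_scope.
Local Open Scope ring_scope.
Local Open Scope complex_scope.
Local Open Scope quotient_scope.

Definition homeomorphism (X Y : topologicalType) (f : X -> Y) : Prop :=
  continuous f /\
  exists g : Y -> X, [/\ cancel f g, cancel g f & continuous g].

Definition locally_trivial_fibration (E B F : topologicalType) (p : E -> B) :
    Prop :=
  continuous p /\
  forall b : B, exists2 U : set B, open_nbhs b U &
    exists2 phi : set_type (p @^-1` U) -> (set_type U * F)%type,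
      homeomorphism phi & forall e, set_val (phi e).1 = p (set_val e).

Arguments locally_trivial_fibration {E B} F p.

Section Configurations.
Variable R : realType.

(* The complex numbers are R[i]; their metric topology is the one that the
   library puts on the alias R[i]^o. *)
Definition ordered_conf_set (n : nat) : set 'rV[R[i]^o]_n :=
  [set z : 'rV[R[i]^o]_n | injective (z ord0)].

Definition ordered_conf (n : nat) : topologicalType :=
  set_type (@ordered_conf_set n).

Definition conf_coord (n : nat) (z : ordered_conf n) (k : 'I_n) : R[i] :=
  set_val z ord0 k.

Definition poly_of_roots (c : R[i]) (n : nat) (z : ordered_conf n) :
    {poly R[i]} :=
  c *: \prod_(k < n) ('X - (conf_coord z k)%:P).

Definition squarefree_split (c : R[i]) (n : nat) : set {poly R[i]} :=
  range (@poly_of_roots c n).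

Definition conf_carrier (c : R[i]) (n : nat) : Type :=
  set_type (@squarefree_split c n).

Definition conf_pi (c : R[i]) (n : nat) (z : ordered_conf n) :
    conf_carrier c n :=
  exist _ (poly_of_roots c z) (mem_set (imageT (@poly_of_roots c n) z)).

Lemma conf_pi_surj (c : R[i]) (n : nat) (q : conf_carrier c n) :
  exists z, conf_pi c z = q.
Proof.
case: q => q qP; have [z _ zq] := set_mem qP.
by exists z; apply: eq_sig_hprop => //=.
Qed.

Definition conf_repr (c : R[i]) (n : nat) (q : conf_carrier c n) :
    ordered_conf n :=
  sval (cid (conf_pi_surj q)).

Lemma conf_reprK (c : R[i]) (n : nat) : cancel (@conf_repr c n) (@conf_pi c n).
Proof. by move=> q; rewrite /conf_repr; case: cid. Qed.

HB.instance Definition _ (c : R[i]) (n : nat) :=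
  isQuotient.Build (ordered_conf n) (conf_carrier c n) (@conf_reprK c n).

(* The unordered configuration space F_n / Sigma_n, with the quotient topology;
   for c != 0 the point {z_1, ..., z_n} is represented by the polynomial
   c * (X - z_1) ... (X - z_n), and the fibres of z |-> \pi z are the orbits of
   Sigma_n (lemma [conf_pi_eq] below). *)
Definition conf (c : R[i]) (n : nat) : topologicalType :=
  quotient_topology (conf_carrier c n).

Definition conf_poly (c : R[i]) (n : nat) (q : conf c n) : {poly R[i]} :=
  @proj1_sig {poly R[i]} _ q.

Lemma conf_poly_inj (c : R[i]) (n : nat) : injective (@conf_poly c n).
Proof. by move=> p q pq; apply: eq_sig_hprop. Qed.

Lemma conf_poly_pi (c : R[i]) (n : nat) (z : ordered_conf n) :
  conf_poly (\pi_(conf c n) z) = poly_of_roots c z.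
Proof. by rewrite pi.unlock. Qed.

Lemma conf_pi_eq (c : R[i]) (n : nat) (z w : ordered_conf n) : c != 0 ->
  \pi_(conf c n) z = \pi_(conf c n) w <->
  exists s : 'S_n, forall k, conf_coord w k = conf_coord z (s k).
Proof.
move=> c0; have prodE (v : ordered_conf n) : \prod_(k < n) ('X - (conf_coord v k)%:P)
    = \prod_(x <- [tuple conf_coord v k | k < n]) ('X - x%:P).
  by rewrite big_map big_enum.
split=> [zw|[s zw]]; last first.
  apply: conf_poly_inj; rewrite !conf_poly_pi /poly_of_roots; congr (_ *: _).
  by rewrite (reindex_perm s); apply: eq_bigr => k _; rewrite zw.
have := congr1 (@conf_poly c n) zw; rewrite !conf_poly_pi.
move=> /(scalerI c0); rewrite !prodE => /esym /prod_XsubC_eq /tuple_permP[s sE].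
exists s => k; have /(congr1 (fun t => tnth t k)) := val_inj sE.
by rewrite !tnth_mktuple.
Qed.

(* Parametrized by the segment t = a + s (b - a); the path is immaterial, since
   Q has a primitive (lemma [line_integral_deriv] below). *)
Definition line_integral (Q : {poly R[i]}) (a b : R[i]) : R[i] :=
  let f (s : R) := Q.[a + s%:C * (b - a)] * (b - a) in
  (\int[lebesgue_measure]_(s in `[0%R, 1%R]) complex.Re (f s)) +i*
  (\int[lebesgue_measure]_(s in `[0%R, 1%R]) complex.Im (f s)).

Definition QC_set (n : nat) : set (conf n%:R n.-1) :=
  [set q | exists2 b : ordered_conf n.-1, conf_poly q = poly_of_roots n%:R b &
     forall k j, k != j ->
       line_integral (conf_poly q) (conf_coord b k) (conf_coord b j) != 0].

Definition QC (n : nat) : topologicalType := set_type (@QC_set n).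

Definition RC_set (n : nat) : set (conf 1 n) :=
  [set p | exists q : conf n%:R n.-1, exists b : ordered_conf n.-1,
     exists c : R[i],
     [/\ QC_set q, conf_poly q = poly_of_roots n%:R b,
         forall k, c != line_integral (conf_poly q) 0 (conf_coord b k) &
         forall x, (conf_poly p).[x] = line_integral (conf_poly q) 0 x - c]].

Definition RC (n : nat) : topologicalType := set_type (@RC_set n).

Lemma real_imag_poly (u : {poly R[i]}) : exists r m : {poly R},
  u = map_poly (real_complex R) r + 'i%C *: map_poly (real_complex R) m.
Proof.
elim/poly_ind: u => [|u [a b]]; first by exists 0, 0; rewrite !rmorph0 scaler0 addr0.
move=> [r [m ->]]; exists (r * 'X + a%:P), (m * 'X + b%:P).
rewrite !rmorphD !rmorphM /= !map_polyX !map_polyC /= scalerDr mulrDl -scalerAl.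
have -> : (a +i* b)%:P = (a%:C)%:P + 'i%C *: (b%:C)%:P :> {poly R[i]}.
  by rewrite -mul_polyC -polyCM -polyCD; congr (_%:P); simpc.
by rewrite !addrA; congr (_ + _); rewrite -!addrA; congr (_ + _); rewrite addrC.
Qed.

Lemma Rintegral_deriv_poly (p : {poly R}) :
  \int[lebesgue_measure]_(s in `[0%R, 1%R]) (p^`()).[s] = p.[1] - p.[0].
Proof.
rewrite /Rintegral (@continuous_FTC2 _ (horner p^`()) (horner p)) //.
- apply: continuous_subspaceT => x; exact: continuous_horner.
- split.
  + by move=> x _; exact: derivable_horner.
  + by apply: cvg_at_right_filter; exact: continuous_horner.
  + by apply: cvg_at_left_filter; exact: continuous_horner.
- by move=> x _; rewrite derivE.
Qed.

Lemma line_integral_deriv (T : {poly R[i]}) (a b : R[i]) :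
  line_integral T^`() a b = T.[b] - T.[a].
Proof.
pose u := T \Po (a%:P + (b - a) *: 'X).
have uE s : u.[s] = T.[a + s * (b - a)].
  by rewrite horner_comp !hornerE mulrC.
have u'E s : (u^`()).[s] = (T^`()).[a + s * (b - a)] * (b - a).
  rewrite deriv_comp hornerM horner_comp !hornerE mulrC.
  by rewrite derivD derivC derivZ derivX !hornerE mulrC [s * _]mulrC.
have [r [m um]] := real_imag_poly u.
have ev (r' m' : {poly R}) s :
    (map_poly (real_complex R) r' + 'i%C *: map_poly (real_complex R) m').[s%:C]
    = r'.[s] +i* m'.[s].
  by rewrite !hornerE !horner_map /=; simpc.
have u'm : u^`() = map_poly (real_complex R) r^`()
                   + 'i%C *: map_poly (real_complex R) m^`().
  by rewrite um derivD derivZ !deriv_map.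
rewrite /line_integral.
under eq_Rintegral do rewrite -u'E u'm ev /=.
under [X in _ +i* X]eq_Rintegral do rewrite -u'E u'm ev /=.
rewrite !Rintegral_deriv_poly.
have -> : T.[b] = u.[1%:C] by rewrite uE mul1r addrC subrK.
have -> : T.[a] = u.[0%:C] by rewrite uE mul0r addr0.
by rewrite um !ev; simpc.
Qed.

Lemma line_integral_primitive (P Q : {poly R[i]}) (c : R[i]) :
  (forall x, P.[x] = line_integral Q 0 x - c) -> P^`() = Q.
Proof.
move=> PQ; pose T : {poly R[i]} := \poly_(i < (size Q).+1) (Q`_i.-1 / i%:R).
have TQ : T^`() = Q.
  apply/polyP => i; rewrite coef_deriv coef_poly ltnS /=.
  case: ltnP => [_|sQ]; last by rewrite mul0rn nth_default.
  by rewrite -[LHS]mulr_natr divfK // pnatr_eq0.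
suff -> : P = T - (T.[0] + c)%:P by rewrite derivB derivC subr0.
apply/eqP; rewrite -subr_eq0; set q := _ - _.
have qx x : q.[x] = 0.
  rewrite /q !hornerE PQ -TQ line_integral_deriv; ring.
apply: contraT => q0; have := max_poly_roots q0 (rs := [seq i%:R | i <- iota 0 (size q)]).
rewrite size_map size_iota ltnn; apply.
  by apply/allP => x _; apply/rootP.
rewrite map_inj_uniq ?iota_uniq // => i j /eqP; rewrite eqr_nat => /eqP //.
Qed.

Section Derivative.
Variable n : nat.

Lemma deriv_squarefree (p : RC n) :
  (conf_poly (set_val p))^`() \in @squarefree_split n%:R n.-1.
Proof.
have [q [b [c [_ qb _ pq]]]] := set_valP p.
by rewrite (line_integral_primitive pq) qb; apply/mem_set; exists b.
Qed.

Definition deriv_conf (p : RC n) : conf n%:R n.-1 :=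
  exist _ (conf_poly (set_val p))^`() (deriv_squarefree p) :
    conf_carrier n%:R n.-1.

Lemma deriv_conf_QC (p : RC n) : deriv_conf p \in @QC_set n.
Proof.
have [q [b [c [qQ qb _ pq]]]] := set_valP p; apply/mem_set.
rewrite (_ : deriv_conf p = q) //; apply: conf_poly_inj.
exact: (line_integral_primitive pq).
Qed.

Definition derivative_map (p : RC n) : QC n := exist _ (deriv_conf p) (deriv_conf_QC p).

Lemma conf_poly_derivative (p : RC n) :
  conf_poly (set_val (derivative_map p)) = (conf_poly (set_val p))^`().
Proof. by []. Qed.

End Derivative.

Definition punctured_plane (n : nat) (w : ordered_conf n) : topologicalType :=
  set_type (~` range (conf_coord w) : set R[i]^o).

End Configurations.

(* Main.v *)
(* A polynomial is determined by its derivative Q and its constant term -a, so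
   R C_n is the space of pairs (Q, a) with a outside the n - 1 critical values
   of the primitive of Q vanishing at 0; these are pairwise distinct because Q
   lies in Q C_{n-1}.

   A function into a configuration space is continuous as soon as the
   corresponding polynomials converge pointwise: |P(x)| = |c| prod |x - z_k|
   forces a root of P near every x where |P(x)| is small, so nearby polynomials
   have nearby roots.  In particular the roots, hence the critical values, can
   locally be ordered continuously.

   Two shears of the plane, given by Lagrange interpolation, carry any
   configuration whose points have distinct real parts to {0, i, 2i, ...}; this
   depends continuously on the configuration, and any configuration has
   distinct real parts after a rotation.  Straightening the critical values and
   then unstraightening to w is the local trivialization.  The section is
   a = 1 + sum of the moduli of the critical values. *)
Require Import Defs.
From mathcomp Require Import all_boot all_order all_algebra.
From mathcomp Require Import perm separable generic_quotient complex ring.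
From mathcomp Require Import all_classical all_reals all_analysis.

Set Implicit Arguments.
Unset Strict Implicit.
Unset Printing Implicit Defensive.

Import Order.TTheory GRing.Theory Num.Theory.
Import numFieldNormedType.Exports.

Local Open Scope classical_set_scope.
Local Open Scope ring_scope.
Local Open Scope complex_scope.
Local Open Scope quotient_scope.

(** * Limits of polynomials and of complex functions *)

Section FieldLimits.
Variables (K : numFieldType) (T : Type) (F : set_system T).
Context {FF : Filter F}.

Lemma cvg_sum_seq (I : Type) (r : seq I) (P : pred I) (f : I -> T -> K) (a : I -> K) :
  (forall i, P i -> f i @ F --> a i) ->
  (fun t => \sum_(i <- r | P i) f i t) @ F --> \sum_(i <- r | P i) a i.
Proof.
move=> fa; elim: r => [|i r IHr].
  by under eq_fun do rewrite big_nil; rewrite big_nil; exact: cvg_cst.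
under eq_fun do rewrite big_cons; rewrite big_cons.
by case: ifP => // /fa fi; exact: cvgD.
Qed.

Lemma cvg_prod_seq (I : Type) (r : seq I) (P : pred I) (f : I -> T -> K) (a : I -> K) :
  (forall i, P i -> f i @ F --> a i) ->
  (fun t => \prod_(i <- r | P i) f i t) @ F --> \prod_(i <- r | P i) a i.
Proof.
move=> fa; elim: r => [|i r IHr].
  by under eq_fun do rewrite big_nil; rewrite big_nil; exact: cvg_cst.
under eq_fun do rewrite big_cons; rewrite big_cons.
by case: ifP => // /fa fi; exact: cvgM.
Qed.

Lemma cvg_exprn (f : T -> K) (a : K) n : f @ F --> a -> (fun t => f t ^+ n) @ F --> a ^+ n.
Proof.
move=> fa; elim: n => [|n IHn]; first by under eq_fun do rewrite expr0; exact: cvg_cst.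
by under eq_fun do rewrite exprS; rewrite exprS; exact: cvgM.
Qed.

(* Coefficientwise convergence, which controls the values of the polynomials
   only under a bound on their sizes. *)
Definition cvg_poly (p : T -> {poly K}) (q : {poly K}) :=
  forall i, (fun t => (p t)`_i) @ F --> q`_i.

(** The common bound [n] turns evaluation into a sum of fixed length, whose terms converge one by
    one even when the point of evaluation moves. *)
Lemma cvg_horner (n : nat) (p : T -> {poly K}) (q : {poly K}) (f : T -> K) (a : K) :
  (forall t, (size (p t) <= n)%N) -> (size q <= n)%N ->
  cvg_poly p q -> f @ F --> a -> (fun t => (p t).[f t]) @ F --> q.[a].
Proof.
move=> pn qn pq fa; rewrite (horner_coef_wide _ qn).
under eq_fun do rewrite (horner_coef_wide _ (pn _)).
by apply: cvg_sum_seq => i _; apply: cvgM; [exact: pq|exact: cvg_exprn].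
Qed.

Lemma cvg_poly_prod_XsubC (I : Type) (r : seq I) (f : I -> T -> K) (a : I -> K) :
  (forall i, f i @ F --> a i) ->
  cvg_poly (fun t => \prod_(i <- r) ('X - (f i t)%:P)) (\prod_(i <- r) ('X - (a i)%:P)).
Proof.
move=> fa; elim: r => [|j r IHr] i.
  by under eq_fun do rewrite big_nil; rewrite big_nil; exact: cvg_cst.
under eq_fun do rewrite big_cons coefM; rewrite big_cons coefM.
apply: cvg_sum_seq => k _; apply: cvgM; last exact: IHr.
under eq_fun do rewrite coefB coefC; rewrite coefB coefC.
apply: cvgB; first exact: cvg_cst.
by case: eqP => _; [exact: fa|exact: cvg_cst].
Qed.

End FieldLimits.

Section ComplexPlane.
Variable R : realType.
Local Notation C := (R[i]^o).

Lemma near_complex (x : C) (e : R) : 0 < e -> \forall y \near x, `|(x : R[i]) - y| < e%:C.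
Proof.
move=> e0; have e0' : 0 < e%:C :> R[i] by rewrite ltcR.
exact: (nbhsx_ballx x _ e0').
Qed.

Lemma Re_continuous : continuous (@complex.Re R : C -> R).
Proof.
move=> x; apply/(@cvgrPdist_lt R R _ (nbhs x) (nbhs_filter (x : C))).
move=> e e0; have := near_complex x e0; apply: filterS => y.
rewrite -ltcR; apply: le_lt_trans.
by have := normc_ge_Re ((x : R[i]) - y); case: (x) (y) => [a b] [c d] /=.
Qed.

Lemma Im_continuous : continuous (@complex.Im R : C -> R).
Proof.
have -> : @complex.Im R = @complex.Re R \o ( *%R (- 'i%C)).
  by apply/funext => -[a b]; rewrite /=; simpc.
move=> x; apply: (@continuous_comp C C R); last exact: Re_continuous.
exact: (@mulrl_continuous C _ x).
Qed.

Lemma real_complex_continuous : continuous (real_complex R : R -> C).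
Proof.
move=> x; apply/(@cvgrPdist_lt _ C _ (nbhs x) (nbhs_filter x)) => e e0.
(* A positive element of [R[i]] is real, so the radius can be handled in [R]. *)
have [e1 e2] : 0 < complex.Re e /\ e = (complex.Re e)%:C.
  by case: e e0 => a b; rewrite ltcE /= => /andP[/eqP -> ->].
have := (@cvgrPdist_lt R R _ (nbhs x) (nbhs_filter (x : R)) id x).1 cvg_id _ e1.
apply: filterS => y; rewrite e2 /= => h.
by rewrite -(rmorphB (real_complex R)) normc_def /= expr0n addr0 sqrtr_sqr ltcR.
Qed.

(* The library's [cvgM], [cvgD], [cvgB], [cvgN] at fixed types: applied directly
   to goals on [R[i]^o], they can make unification diverge. *)
Section Operations.
Context {T : Type} {F : set_system T} {FF : Filter F}.
Variables (f g : T -> R[i]) (a b : R[i]).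
Hypotheses (fa : (f : T -> C) @ F --> (a : C)) (gb : (g : T -> C) @ F --> (b : C)).

Lemma cvgC_M : (fun t => f t * g t : C) @ F --> (a * b : C).
Proof. exact: cvgM fa gb. Qed.

Lemma cvgC_D : (fun t => f t + g t : C) @ F --> (a + b : C).
Proof. exact: cvgD fa gb. Qed.

Lemma cvgC_B : (fun t => f t - g t : C) @ F --> (a - b : C).
Proof. exact: cvgB fa gb. Qed.

Lemma cvgC_N : (fun t => - f t : C) @ F --> (- a : C).
Proof. exact: cvgN fa. Qed.

End Operations.

End ComplexPlane.

(** * The topology of unordered configuration spaces *)

Lemma set_val_continuous (X : topologicalType) (A : set X) :
  continuous (set_val : set_type A -> X).
Proof. exact: initial_continuous. Qed.

Lemma cvg_set_type (X : topologicalType) (A : set X) (T : Type) (F : set_system T)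
    {FF : Filter F} (f : T -> set_type A) (a : set_type A) :
  (fun t => set_val (f t)) @ F --> set_val a -> f @ F --> a.
Proof.
move=> fa B [_ /= [[U oU <-] aU UB]].
have FU : F ((fun t => set_val (f t)) @^-1` U).
  by apply: fa; exact: open_nbhs_nbhs.
by apply: filterS FU => t; exact: UB.
Qed.

(** * Antiderivatives and line integrals of polynomials *)

Section Primitive.
Variable R : realType.
Local Notation C := (R[i]^o).

(* For [i = 0] the coefficient is [p`_0 / 0 = 0]. *)
Definition primitive (p : {poly R[i]}) : {poly R[i]} :=
  \poly_(i < (size p).+1) (p`_i.-1 / i%:R).

Lemma coef_primitive p i : (primitive p)`_i = p`_i.-1 / i%:R.
Proof.
rewrite coef_poly ltnS; case: ltnP => // pi.
case: i pi => [|i] pi; first by rewrite invr0 mulr0.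
by rewrite nth_default ?mul0r.
Qed.

Lemma size_primitive p : (size (primitive p) <= (size p).+1)%N.
Proof. exact: size_poly. Qed.

Lemma primitive0 p : (primitive p).[0] = 0.
Proof. by rewrite horner_coef0 coef_primitive invr0 mulr0. Qed.

Lemma deriv_primitive p : (primitive p)^`() = p.
Proof.
apply/polyP => i; rewrite coef_deriv coef_primitive /=.
by rewrite -[LHS]mulr_natr divfK // pnatr_eq0.
Qed.

Lemma line_integralE (p : {poly R[i]}) a b :
  line_integral p a b = (primitive p).[b] - (primitive p).[a].
Proof. by rewrite -[p in LHS]deriv_primitive line_integral_deriv. Qed.

Lemma line_integral0E (p : {poly R[i]}) b : line_integral p 0 b = (primitive p).[b].
Proof. by rewrite line_integralE primitive0 subr0. Qed.

Lemma primitive_deriv (p : {poly R[i]}) : primitive p^`() = p - (p.[0])%:P.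
Proof.
apply/polyP => i; rewrite coef_primitive coef_deriv coefB coefC horner_coef0.
case: i => [|i] /=; first by rewrite invr0 mulr0 subrr.
by rewrite subr0 -[X in X / _]mulr_natr mulfK // pnatr_eq0.
Qed.

Lemma cvg_primitive (T : Type) (F : set_system T) {FF : Filter F}
    (p : T -> {poly C}) (q : {poly C}) :
  cvg_poly F p q -> cvg_poly F (fun t => primitive (p t)) (primitive q).
Proof.
move=> pq i; rewrite coef_primitive; under eq_fun do rewrite coef_primitive.
by apply: (@cvgM C); [exact: pq|exact: cvg_cst].
Qed.

End Primitive.

(** * Convergence of polynomials versus convergence of their roots *)

Section ConfTopology.
Variable R : realType.
Local Notation C := (R[i]^o).
Implicit Types (n : nat) (c : R[i]).

Lemma conf_coord_inj n (z : ordered_conf R n) : injective (conf_coord z).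
Proof. by have := set_valP z. Qed.

Lemma conf_coord_continuous n (k : 'I_n) :
  continuous (fun z : ordered_conf R n => conf_coord z k : C).
Proof.
move=> z; apply: (@continuous_comp _ _ _ set_val (fun M : 'rV[C]_n => M ord0 k)).
  exact: set_val_continuous.
exact: coord_continuous.
Qed.

Lemma ordered_confP n (f : 'I_n -> R[i]) : injective f ->
  exists z : ordered_conf R n, conf_coord z =1 f.
Proof.
move=> fI.
have fP : (\row_k f k : 'rV[C]_n) \in @ordered_conf_set R n.
  by rewrite inE => i j; rewrite !mxE => /fI.
exists (exist (fun M => M \in @ordered_conf_set R n) _ fP) => k.
by rewrite /conf_coord /= set_valE /= mxE.
Qed.

Lemma nbhs_ordered_conf n (z : ordered_conf R n) (A : set (ordered_conf R n)) :
  nbhs z A -> exists2 e : R, 0 < e & forall w : ordered_conf R n,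
    (forall k, `|conf_coord z k - conf_coord w k| < e%:C) -> A w.
Proof.
move=> [_ /= [[U oU <-] zU UA]].
have [P zP PU] : nbhs (set_val z) U by exact: open_nbhs_nbhs.
have zPk k : exists e : R, 0 < e /\ forall x : C, `|conf_coord z k - x| < e%:C -> P ord0 k x.
  have /nbhs_ballP[e /= e0 eP] := zP ord0 k.
  exists (complex.Re e); move: e0 eP; case: e => a b.
  rewrite ltcE /= => /andP[/eqP -> a0] eP; split => // x; exact: eP.
have {}zPk k := cid (zPk k).
(* Starting the minimum from 1 keeps it positive when [n = 0]. *)
exists (\big[Order.min/1]_k sval (zPk k)).
  by elim/big_ind: _ => [|x y x0 y0|k _]; rewrite ?ltr01 ?lt_min ?x0//; case: (zPk k) => ? [].
move=> w zw; apply: UA; apply: PU => i k; rewrite ord1.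
apply: (svalP (zPk k)).2; apply: lt_le_trans (zw k) _.
by rewrite lecR; exact: bigmin_le.
Qed.

(* [|P(x)| = |c| prod_k |x - z_k|], so a small value of [P] at [x] forces a
   root near [x]. *)
Lemma small_value_root n c (z : ordered_conf R n) (x : R[i]) (e : R) : c != 0 -> 0 < e ->
  `|(poly_of_roots c z).[x]| < `|c| * (e%:C) ^+ n -> exists k, `|x - conf_coord z k| < e%:C.
Proof.
move=> c0 e0; have e0C : 0 < e%:C :> R[i] by rewrite ltcR.
rewrite hornerZ horner_prod normrM ltr_pM2l ?normr_gt0//.
rewrite normr_prod => small; apply: contrapT => /forallNP far.
move: small; apply/negP; rewrite -real_leNgt ?normr_real//.
- rewrite -[X in _ ^+ X]card_ord -prodr_const; apply: ler_prod => k _.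
  rewrite hornerXsubC; apply/andP; split; first exact: ltW.
  by rewrite real_leNgt ?normr_real ?gtr0_real//; exact/negP/far.
- by apply: rpredX; rewrite gtr0_real.
- by apply: rpred_prod => k _; exact: normr_real.
Qed.

Lemma poly_of_roots_root n c (z : ordered_conf R n) k :
  (poly_of_roots c z).[conf_coord z k] = 0.
Proof. by rewrite hornerZ horner_prod (bigD1 k)//= hornerXsubC subrr mul0r mulr0. Qed.

Lemma conf_polyE n c (q : conf c n) : exists2 z : ordered_conf R n,
  \pi_(conf c n) z = q & conf_poly q = poly_of_roots c z.
Proof. by exists (repr q); rewrite ?reprK// -conf_poly_pi reprK. Qed.

Lemma ordered_conf_separated n (z : ordered_conf R n) :
  exists2 d : R, 0 < d & forall k j, k != j -> d%:C <= `|conf_coord z k - conf_coord z j|.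
Proof.
pose dist (p : 'I_n * 'I_n) := complex.Re `|conf_coord z p.1 - conf_coord z p.2|.
have distE p : (dist p)%:C = `|conf_coord z p.1 - conf_coord z p.2|.
  by rewrite RRe_real// normr_real.
exists (\big[Order.min/1]_(p | p.1 != p.2) dist p).
  elim/big_ind: _ => [|x y x0 y0|p pN]; rewrite ?ltr01 ?lt_min ?x0//.
  by rewrite -ltcR distE normr_gt0 subr_eq0 (inj_eq (@conf_coord_inj _ _)).
move=> k j kj; rewrite -(distE (k, j)) lecR.
exact: (@bigmin_le_cond _ _ _ _ (k, j)).
Qed.

(** Near the limit the polynomials are small at each root [z_k], which forces a root of [f t] close
    to each [z_k]. The discs around the [z_k] are disjoint, so these roots are distinct; there are
    [n] of them, hence they are all the roots, and they come ordered like [z]. *)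
Lemma near_ordered_roots n c (z : ordered_conf R n) (A : set (ordered_conf R n))
    (T : Type) (F : set_system T) {FF : Filter F} (f : T -> conf c n) :
  c != 0 -> nbhs z A ->
  (forall x, (fun t => (conf_poly (f t)).[x] : C) @ F --> ((poly_of_roots c z).[x] : C)) ->
  \forall t \near F, exists2 w, A w & \pi_(conf c n) w = f t.
Proof.
move=> c0 /nbhs_ordered_conf[e e0 eA] fz.
have [d d0 dz] := ordered_conf_separated z.
(* The bound [e] keeps the reordered roots in [A]; the bound [d / 2] makes the discs disjoint. *)
pose r := Order.min e (d / 2).
have r0 : 0 < r by rewrite lt_min e0 divr_gt0.
have small : \forall t \near F, forall k,
    `|(conf_poly (f t)).[conf_coord z k]| < `|c| * (r%:C) ^+ n.
  apply: filter_forall => k.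
  have := fz (conf_coord z k); rewrite poly_of_roots_root => fz0.
  apply: (@cvgr0_norm_lt C C _ _ FF _ fz0).
  by rewrite mulr_gt0 ?normr_gt0// exprn_gt0// ltcR.
apply: filterS small => t small.
have [v vt vE] := conf_polyE (f t).
have vk k : exists j, `|conf_coord z k - conf_coord v j| < r%:C.
  by apply: (small_value_root c0 r0); rewrite -vE.
have {vk}[s sv] := fin_all_exists vk.
have sI : injective s.
  move=> k j skj; apply: contrapT => /eqP/dz; apply/negP.
  have d0C : 0 < d%:C :> R[i] by rewrite ltcR.
  rewrite -real_ltNge ?normr_real ?gtr0_real//.
  apply: (@lt_le_trans _ _ (r%:C + r%:C)).
    rewrite (le_lt_trans (ler_distD (conf_coord v (s k)) _ _))// ltrD// distrC skj.
    exact: sv.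
  by rewrite -rmorphD lecR [leRHS]splitr lerD// ge_min lexx orbT.
(* An injective self-map of ['I_n] is a permutation, so [w] is a reordering of [v]. *)
have [w wE] : exists w : ordered_conf R n, conf_coord w =1 conf_coord v \o s.
  by apply: ordered_confP => k j /conf_coord_inj/sI.
exists w; last first.
  rewrite -vt; apply/esym/conf_pi_eq => //.
  by exists (perm sI) => k; rewrite wE permE.
apply: eA => k; rewrite wE; apply: lt_le_trans (sv k) _.
by rewrite lecR ge_min lexx.
Qed.

(** A neighbourhood of [q] pulls back to one of any ordering [z] of its roots, and
    [near_ordered_roots] finds orderings of the [f t] in it. *)
Lemma cvg_conf n c (q : conf c n) (T : Type) (F : set_system T) {FF : Filter F}
    (f : T -> conf c n) : c != 0 ->
  (forall x, (fun t => (conf_poly (f t)).[x] : C) @ F --> ((conf_poly q).[x] : C)) ->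
  f @ F --> q.
Proof.
move=> c0 fq A; have [z zq qE] := conf_polyE q; rewrite -zq => zA.
have := @pi_continuous _ (conf c n) z _ zA.
rewrite qE in fq => /(near_ordered_roots c0) => /(_ _ F _ _ fq).
by apply: filterS => t [w Aw wt]; rewrite /= -wt.
Qed.

Lemma size_poly_of_roots n c (z : ordered_conf R n) :
  (size (poly_of_roots c z) <= n.+1)%N.
Proof.
by rewrite (leq_trans (size_scale_leq _ _))// size_prod_XsubC /index_enum -enumT size_enum_ord.
Qed.

Lemma size_conf_poly n c (q : conf c n) : (size (conf_poly q) <= n.+1)%N.
Proof. by have [z _ ->] := conf_polyE q; exact: size_poly_of_roots. Qed.

Lemma cvg_poly_of_roots n c (z : ordered_conf R n) :
  cvg_poly (K := C) (nbhs z) (@poly_of_roots R c n) (poly_of_roots c z).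
Proof.
move=> i; rewrite coefZ; under eq_fun do rewrite coefZ.
apply: (@cvgM C); first exact: cvg_cst.
apply: (@cvg_poly_prod_XsubC C) => k; exact: conf_coord_continuous.
Qed.

(** The opposite direction to [cvg_conf]: coefficients are continuous in the ordered roots, and
    continuity on the quotient is tested after composing with the projection. *)
Lemma cvg_conf_poly n c (q : conf c n) :
  cvg_poly (K := C) (nbhs q) (@conf_poly R c n) (conf_poly q).
Proof.
move=> i; move: q.
apply/(@quotient_continuous _ _ C) => z /=.
rewrite (_ : _ \o _ = fun z => (poly_of_roots c z)`_i); last first.
  by apply/funext => w /=; rewrite conf_poly_pi.
exact: cvg_poly_of_roots.
Qed.

Lemma cvg_conf_horner n c (q : conf c n) (x : R[i]) :
  (fun p : conf c n => (conf_poly p).[x] : C) @ q --> ((conf_poly q).[x] : C).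
Proof.
apply: (@cvg_horner C _ _ (nbhs_filter q) n.+1 (@conf_poly R c n)) => //; try exact: size_conf_poly.
- exact: cvg_conf_poly.
- exact: cvg_cst.
Qed.

(** This is [near_ordered_roots] for the identity family near the class of [z]. *)
Lemma conf_pi_open n c (z : ordered_conf R n) (A : set (ordered_conf R n)) :
  c != 0 -> nbhs z A -> nbhs (\pi_(conf c n) z) (\pi_(conf c n) @` A).
Proof.
move=> c0 zA.
apply: (@near_ordered_roots n c z A _ _ (nbhs_filter (\pi_(conf c n) z)) id c0 zA) => x.
by rewrite -conf_poly_pi; exact: cvg_conf_horner.
Qed.

End ConfTopology.

(** * Straightening configurations of the plane *)

Section Lagrange.
Variables (K : numFieldType) (m : nat).

Definition lagrange (x y : 'I_m -> K) (s : K) : K :=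
  \sum_k y k * \prod_(j | j != k) ((s - x j) / (x k - x j)).

Lemma lagrangeE (x y : 'I_m -> K) k : injective x -> lagrange x y (x k) = y k.
Proof.
move=> xI; rewrite /lagrange (bigD1 k)//= [X in _ + X]big1 => [|j jk].
  rewrite addr0 big1 ?mulr1// => j jk.
  by rewrite divff// subr_eq0 (inj_eq xI) eq_sym.
by rewrite [X in _ * X](bigD1 k) ?(eq_sym k)//= subrr !mul0r mulr0.
Qed.

(** The denominators converge to differences of the limit nodes, which are nonzero by injectivity of
    [x0]. *)
Lemma cvg_lagrange (T : Type) (F : set_system T) {FF : Filter F}
    (x y : T -> 'I_m -> K) (x0 y0 : 'I_m -> K) (s : T -> K) (s0 : K) :
  injective x0 -> (forall k, (fun t => x t k) @ F --> x0 k) ->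
  (forall k, (fun t => y t k) @ F --> y0 k) -> s @ F --> s0 ->
  (fun t => lagrange (x t) (y t) (s t)) @ F --> lagrange x0 y0 s0.
Proof.
move=> x0I xx yy ss; apply: cvg_sum_seq => k _; apply: cvgM; first exact: yy.
apply: cvg_prod_seq => j jk; apply: cvgM; first exact: cvgB.
by apply: cvgV; [rewrite subr_eq0 (inj_eq x0I) eq_sym|exact: cvgB].
Qed.

End Lagrange.

Section Straighten.
Variable R : realType.
Local Notation C := (R[i]^o).
Local Notation Re := (@complex.Re R).
Local Notation Im := (@complex.Im R).
Variable m : nat.
Implicit Types (u z : R[i]) (v : 'I_m -> R[i]).

Definition horizontal u v : R -> R :=
  lagrange (fun k : 'I_m => k%:R) (fun k => Re (u * v k)).

(** The displacement that brings each rotated point to its height, as a function of the real part.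
    The interpolation nodes are the real parts, which is why they must be made distinct first. *)
Definition vertical u v : R -> R :=
  lagrange (fun k => Re (u * v k)) (fun k => k%:R - Im (u * v k)).

(* After the rotation [u] the points have distinct real parts; the shear
   [vertical] brings the [k]th point to height [k], and the shear [horizontal]
   then moves it to the imaginary axis. *)
Definition straighten u v z : R[i] :=
  let z1 := u * z in
  let z2 := z1 + 'i%C * (vertical u v (Re z1))%:C in
  z2 - (horizontal u v (Im z2))%:C.

Definition unstraighten u v z : R[i] :=
  let z2 := z + (horizontal u v (Im z))%:C in
  u^-1 * (z2 - 'i%C * (vertical u v (Re z2))%:C).

(** Each shear fixes the coordinate that its displacement depends on, so the displacement can be
    recomputed from the image and subtracted. *)
Lemma straightenK u v : u != 0 -> cancel (straighten u v) (unstraighten u v).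
Proof.
move=> u0 z; rewrite /straighten /unstraighten; set z1 := u * z.
have Im_real w (r : R) : Im (w - r%:C) = Im w by case: w => a b /=; rewrite subr0.
have Re_i w (r : R) : Re (w + 'i%C * r%:C) = Re w.
  by case: w => a b; simpc => /=.
by rewrite Im_real subrK Re_i addrK /z1 mulKf.
Qed.

Lemma unstraightenK u v : u != 0 -> cancel (unstraighten u v) (straighten u v).
Proof.
move=> u0 z; rewrite /straighten /unstraighten mulVKf//.
have Im_real w (r : R) : Im (w + r%:C) = Im w by case: w => a b /=; rewrite addr0.
have Re_i w (r : R) : Re (w - 'i%C * r%:C) = Re w.
  by case: w => a b; simpc => /=.
by rewrite Re_i subrK Im_real addrK.
Qed.

(** The target depends on neither [u] nor [v]; this allows straightening one configuration and
    unstraightening to another with matching [k]th points. *)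
Lemma straighten_point u v k : injective (fun k => Re (u * v k)) ->
  straighten u v (v k) = 'i%C * k%:R.
Proof.
move=> vI; rewrite /straighten /vertical (lagrangeE _ _ vI).
have kI : injective (fun k : 'I_m => k%:R : R).
  by move=> i j /eqP; rewrite eqr_nat => /eqP/val_inj.
have -> : u * v k + 'i%C * (k%:R - Im (u * v k))%:C = Re (u * v k) +i* k%:R.
  by case: (u * v k) => a b; simpc; rewrite addrC subrK.
rewrite /horizontal /= (@lagrangeE _ _ _ _ k kI) -(rmorph_nat (real_complex R)) /=.
by simpc.
Qed.

(** Try [u = 1 - i t] with [t] real: [Re (u z) = Re z + t Im z]. Two distinct points collide only at
    a root of the nonzero polynomial [q], so any [t] that is not a root of the product [Q] will
    do. *)
Lemma exists_separating (v : 'I_m -> R[i]) : injective v ->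
  exists2 u, u != 0 & injective (fun k => Re (u * v k)).
Proof.
move=> vI.
pose q (p : 'I_m * 'I_m) : {poly R} :=
  (Re (v p.1) - Re (v p.2))%:P + (Im (v p.1) - Im (v p.2)) *: 'X.
pose Q := \prod_(p | p.1 != p.2) q p.
have Q0 : Q != 0.
  apply/prodf_neq0 => p pN; apply/negP => /eqP qp.
  have := congr1 (coefp 0) qp; have := congr1 (coefp 1) qp.
  rewrite /= !coefD !coefC !coefZ !coefX /= mulr0 mulr1 add0r addr0.
  move=> /eqP; rewrite subr_eq0 => /eqP iE /eqP; rewrite subr_eq0 => /eqP rE.
  move/eqP: pN; apply; apply: vI.
  by case: (v p.1) (v p.2) iE rE => [a b] [c d] /= -> ->.
have [t Qt] : exists t : R, Q.[t] != 0.
  apply: contrapT => /forallNP Qt.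
  have := max_poly_roots Q0 (rs := [seq i%:R | i <- iota 0 (size Q)]).
  rewrite size_map size_iota ltnn => /(_ _ _)/negP; apply => //.
  - apply/allP => x _; apply/rootP; apply: contrapT => /eqP; exact: Qt.
  - by rewrite map_inj_uniq ?iota_uniq // => i j /eqP; rewrite eqr_nat => /eqP.
exists (1 +i* (- t)); first by rewrite eq_complex /= oner_eq0.
move=> k j kj; apply: contrapT => /eqP kNj.
move: Qt; rewrite horner_prod => /prodf_neq0 /(_ (k, j) kNj) /negP; apply.
rewrite /q !hornerE /=; apply/eqP; move: kj.
case: (v k) (v j) => [a b] [c d] /=; rewrite !mul1r !mulNr !opprK => /eqP.
by rewrite -subr_eq0 => /eqP <-; ring.
Qed.

Section Limits.
Context {T : Type} {F : set_system T} {FF : Filter F} (u : R[i]).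
Variables (v : T -> 'I_m -> R[i]) (v0 : 'I_m -> R[i]).
Hypothesis v0I : injective (fun k => Re (u * v0 k)).
Hypothesis vv0 : forall k, (fun t => v t k : C) @ F --> (v0 k : C).

Lemma cvgRe (f : T -> C) (a : C) : f @ F --> a -> Re \o f @ F --> Re a.
Proof. by move=> fa; apply: cvg_comp fa _; exact: Re_continuous. Qed.

Lemma cvgIm (f : T -> C) (a : C) : f @ F --> a -> Im \o f @ F --> Im a.
Proof. by move=> fa; apply: cvg_comp fa _; exact: Im_continuous. Qed.

Lemma cvgRC (f : T -> R) (a : R) : f @ F --> a -> (fun t => (f t)%:C : C) @ F --> (a%:C : C).
Proof. by move=> fa; apply: cvg_comp fa _; exact: real_complex_continuous. Qed.

Lemma cvg_rotated k : (fun t => u * v t k : C) @ F --> (u * v0 k : C).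
Proof. by apply: (@cvgM C); [exact: cvg_cst|exact: vv0]. Qed.

Lemma cvg_vertical (s : T -> R) (s0 : R) : s @ F --> s0 ->
  (fun t => vertical u (v t) (s t)) @ F --> vertical u v0 s0.
Proof.
move=> ss; apply: cvg_lagrange => // k.
  exact: (cvgRe (@cvg_rotated k)).
by apply: cvgB; [exact: cvg_cst|exact: (cvgIm (@cvg_rotated k))].
Qed.

Lemma cvg_horizontal (s : T -> R) (s0 : R) : s @ F --> s0 ->
  (fun t => horizontal u (v t) (s t)) @ F --> horizontal u v0 s0.
Proof.
move=> ss; apply: cvg_lagrange => // [i j /eqP|k|k].
- by rewrite eqr_nat => /eqP/val_inj.
- exact: cvg_cst.
- exact: (cvgRe (@cvg_rotated k)).
Qed.

Lemma cvg_straighten (z : T -> C) (z0 : C) : z @ F --> z0 ->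
  (fun t => straighten u (v t) (z t) : C) @ F --> (straighten u v0 z0 : C).
Proof.
move=> zz.
have uz : (fun t => u * z t : C) @ F --> (u * z0 : C).
  by apply: cvgC_M; [exact: cvg_cst|exact: zz].
have z2 : (fun t => u * z t + 'i%C * (vertical u (v t) (Re (u * z t)))%:C : C) @ F -->
    (u * z0 + 'i%C * (vertical u v0 (Re (u * z0)))%:C : C).
  apply: cvgC_D; first exact: uz.
  apply: cvgC_M; first exact: cvg_cst.
  exact: (cvgRC (cvg_vertical (cvgRe uz))).
apply: cvgC_B; first exact: z2.
exact: (cvgRC (cvg_horizontal (cvgIm z2))).
Qed.

Lemma cvg_unstraighten (z : T -> C) (z0 : C) : z @ F --> z0 ->
  (fun t => unstraighten u (v t) (z t) : C) @ F --> (unstraighten u v0 z0 : C).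
Proof.
move=> zz.
have z2 : (fun t => z t + (horizontal u (v t) (Im (z t)))%:C : C) @ F -->
    (z0 + (horizontal u v0 (Im z0))%:C : C).
  by apply: cvgC_D; [exact: zz|exact: (cvgRC (cvg_horizontal (cvgIm zz)))].
apply: cvgC_M; first exact: cvg_cst.
apply: cvgC_B; first exact: z2.
apply: cvgC_M; first exact: cvg_cst.
exact: (cvgRC (cvg_vertical (cvgRe z2))).
Qed.

End Limits.
End Straighten.

(** * Ordering the roots; critical values *)

Section LocalOrdering.
Variable R : realType.
Local Notation C := (R[i]^o).

Lemma eq_ordered_conf n (z w : ordered_conf R n) :
  (forall k, conf_coord z k = conf_coord w k) -> z = w.
Proof.
move=> zw; apply: val_inj; apply/rowP => k; exact: zw.
Qed.

(** Two orderings of one set differ by a permutation [s]. If both are within [d / 2] of [z], then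
    [z_k] and [z_(s k)] are closer than the separation [d], so [s k = k]. *)
Lemma conf_pi_locally_injective n (c : R[i]) (z : ordered_conf R n) : c != 0 ->
  exists2 A : set (ordered_conf R n), nbhs z A & forall w w', A w -> A w' ->
    \pi_(conf c n) w = \pi_(conf c n) w' -> w = w'.
Proof.
move=> c0; have [d d0 dz] := ordered_conf_separated z.
have near_z : \forall w \near z, forall k, `|conf_coord z k - conf_coord w k| < (d / 2)%:C.
  apply: (@filter_forall _ _ _ (nbhs z) (nbhs_filter z)) => k.
  have d2 : 0 < d / 2 by rewrite divr_gt0.
  exact: (@conf_coord_continuous R n k z _ (near_complex (conf_coord z k) d2)).
exists [set w | forall k, `|conf_coord z k - conf_coord w k| < (d / 2)%:C] => //.
move=> w w' zw zw' /(conf_pi_eq _ _ c0)[s sw]; apply: eq_ordered_conf => k.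
rewrite sw; suff -> : s k = k by [].
apply: contrapT => /eqP/dz; apply/negP.
have d0C : 0 < d%:C :> R[i] by rewrite ltcR.
rewrite -real_ltNge ?normr_real ?gtr0_real// [d]splitr rmorphD.
rewrite (le_lt_trans (ler_distD (conf_coord w' k) _ _))// ltrD//.
  by rewrite sw; exact: zw.
by rewrite distrC; exact: zw'.
Qed.

(** The projection is open and locally injective, so it has continuous local inverses. *)
Lemma local_ordering n (c : R[i]) (z : ordered_conf R n) (N : set (ordered_conf R n)) :
  c != 0 -> nbhs z N ->
  exists (U : set (conf c n)) (r : conf c n -> ordered_conf R n),
    [/\ open U, U (\pi_(conf c n) z) &
      forall q, U q -> [/\ N (r q), \pi_(conf c n) (r q) = q & r @ q --> r q]].
Proof.
move=> c0 zN; have [A zA AI] := @conf_pi_locally_injective n c z c0.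
pose B := (N `&` A)°; have zB : B z by exact: filterI.
have BI w w' : B w -> B w' -> \pi_(conf c n) w = \pi_(conf c n) w' -> w = w'.
  by move=> /interior_subset[_ Aw] /interior_subset[_ Aw']; exact: AI.
have nbhsB w : B w -> nbhs w B.
  by move=> Bw; apply: open_nbhs_nbhs; split => //; exact: open_interior.
pose r q := xget z [set w | B w /\ \pi_(conf c n) w = q].
have rP q : (\pi_(conf c n) @` B) q -> B (r q) /\ \pi_(conf c n) (r q) = q.
  by move=> [w Bw wq]; rewrite /r; case: xgetP => [x -> //|/(_ w)[]].
exists (\pi_(conf c n) @` B), r; split; [|by exists z|].
  by rewrite openE => _ [w Bw <-]; apply: conf_pi_open => //; exact: nbhsB.
move=> q Uq; have [Brq rq] := rP q Uq; split=> //.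
  by have [] := interior_subset Brq.
(* Openness covers a neighbourhood of [q] by classes of points of [V] and [B]; injectivity on [B]
   makes [r] return exactly those points. *)
move=> V rV; have VB : nbhs (r q) (V `&` B) by apply: filterI => //; exact: nbhsB.
have := conf_pi_open c0 VB; rewrite rq; apply: filterS => q' [w [Vw Bw] wq'].
have [Br' r'] : B (r q') /\ \pi_(conf c n) (r q') = q' by apply: rP; exists w.
suff rw : r q' = w by rewrite /= rw.
by apply: BI => //; rewrite r'.
Qed.

End LocalOrdering.

(** * Polynomials with prescribed derivative and constant term *)

Section DerivativeMap.
Variable R : realType.
Local Notation C := (R[i]^o).

Lemma poly_of_roots_eq0 n (c : R[i]) (z : ordered_conf R n) x : c != 0 ->
  (poly_of_roots c z).[x] = 0 -> exists k, x = conf_coord z k.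
Proof.
move=> c0 /eqP; rewrite hornerZ mulf_eq0 (negPf c0)/= horner_prod => /eqP/eqP.
move=> /prodf_eq0[k _]; rewrite hornerXsubC subr_eq0 => /eqP xk.
by exists k.
Qed.

Definition critical_value n (b : ordered_conf R n.-1) (k : 'I_n.-1) : R[i] :=
  (primitive (poly_of_roots n%:R b)).[conf_coord b k].

Variable n : nat.
Hypothesis n_gt0 : (0 < n)%N.

Let n_neq0 : n%:R != 0 :> R[i]. Proof. by rewrite pnatr_eq0 -lt0n. Qed.

Lemma critical_value_perm (b b' : ordered_conf R n.-1) :
  poly_of_roots n%:R b = poly_of_roots n%:R b' ->
  forall k, exists2 j, conf_coord b k = conf_coord b' j &
    critical_value b k = critical_value b' j.
Proof.
move=> bb' k; have [|j kj] := @poly_of_roots_eq0 _ n%:R b' (conf_coord b k) n_neq0.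
  by rewrite -bb' poly_of_roots_root.
by exists j => //; rewrite /critical_value bb' kj.
Qed.

(** The integral between two roots is a difference of critical values. Membership in [QC_set]
    provides this for one ordering [b'], and [critical_value_perm] transfers it to [b]. *)
Lemma critical_value_inj (q : QC R n) (b : ordered_conf R n.-1) :
  conf_poly (set_val q) = poly_of_roots n%:R b -> injective (@critical_value n b).
Proof.
move=> qb; have [b' qb' b'P] := set_valP q => k k'.
have bb' : poly_of_roots n%:R b = poly_of_roots n%:R b' by rewrite -qb.
have [j bj ->] := critical_value_perm bb' k.
have [j' bj' ->] := critical_value_perm bb' k'.
have [jj'|jj'] := eqVneq j j'.
  by move=> _; apply: (@conf_coord_inj _ _ b); rewrite bj bj' jj'.
have := b'P _ _ jj'; rewrite line_integralE qb' subr_eq0 => /eqP + /esym.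
by [].
Qed.

(* The paper's [gamma]. *)
Definition neg_const_coef (p : RC R n) : R[i] := - (conf_poly (set_val p)).[0].

Lemma RC_polyE (p : RC R n) : conf_poly (set_val p) =
  primitive (conf_poly (set_val (derivative_map p))) - (neg_const_coef p)%:P.
Proof. by rewrite conf_poly_derivative primitive_deriv /neg_const_coef polyCN opprK subrK. Qed.

Lemma RC_inj (p p' : RC R n) : derivative_map p = derivative_map p' ->
  neg_const_coef p = neg_const_coef p' -> p = p'.
Proof.
move=> pd pc; apply: val_inj; apply: conf_poly_inj.
by rewrite [LHS]RC_polyE [RHS]RC_polyE pd pc.
Qed.

(** Differentiating identifies the [q] hidden in [RC_set], and evaluating at 0 identifies its
    constant [c]. *)
Lemma neg_const_coef_noncritical (p : RC R n) (b : ordered_conf R n.-1) k :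
  conf_poly (set_val (derivative_map p)) = poly_of_roots n%:R b ->
  neg_const_coef p != critical_value b k.
Proof.
have [q [b' [c [_ qb' cP pq]]]] := set_valP p => pb.
have qp : conf_poly (set_val (derivative_map p)) = conf_poly q.
  by rewrite conf_poly_derivative (line_integral_primitive pq).
rewrite qb' pb in qp; have [j _ ->] := critical_value_perm qp k.
have -> : neg_const_coef p = c by rewrite /neg_const_coef pq line_integral0E primitive0 sub0r opprK.
by have := cP j; rewrite line_integral0E qb'.
Qed.

Lemma neg_const_coefE (p : RC R n) (Q : {poly R[i]}) a :
  conf_poly (set_val p) = primitive Q - a%:P -> neg_const_coef p = a.
Proof.
by move=> pE; rewrite /neg_const_coef pE hornerD hornerN hornerC primitive0 sub0r opprK.
Qed.

(** The polynomial [P] is monic of degree [n] and splits over the complex numbers. A multiple root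
    would also be a root of [Q], where the primitive would take the value [a], making [a]
    critical. *)
Lemma RC_exists (q : QC R n) (b : ordered_conf R n.-1) (a : R[i]) :
  conf_poly (set_val q) = poly_of_roots n%:R b -> (forall k, a != critical_value b k) ->
  exists2 p : RC R n, derivative_map p = q &
    conf_poly (set_val p) = primitive (conf_poly (set_val q)) - a%:P.
Proof.
move=> qb aP; set Q := conf_poly _ in qb *; set P := primitive Q - a%:P.
have dP : P^`() = Q by rewrite derivB derivC subr0 deriv_primitive.
have sQ : size Q = n.
  by rewrite qb size_scale// size_prod_XsubC /index_enum -enumT size_enum_ord prednK.
have lQ : Q`_n.-1 = n%:R.
  have := lead_coefZ n%:R (\prod_(k < n.-1) ('X - (conf_coord b k)%:P)).
  rewrite -/(poly_of_roots n%:R b) -qb lead_coefE sQ => ->.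
  by rewrite (monicP (monic_prod_XsubC _ _ _)) mulr1.
(* The leading coefficient [n] of [Q] is divided by [n]; the constant [a] does not reach index
   [n > 0]. *)
have Pn : P`_n = 1.
  by rewrite coefB coefC coef_primitive lQ divff// (gtn_eqF n_gt0) subr0.
have sP : size P = n.+1.
  apply/eqP; rewrite eqn_leq; apply/andP; split.
    rewrite (leq_trans (size_polyD _ _))// geq_max size_polyN.
    rewrite (leq_trans (size_polyC_leq1 _))// andbT.
    by rewrite (leq_trans (size_primitive _))// sQ.
  by rewrite ltnNge; apply/negP => /leq_sizeP/(_ n (leqnn _))/eqP; rewrite Pn oner_eq0.
have [r Pr] := closed_field_poly_normal P.
have lP : lead_coef P = 1 by rewrite lead_coefE sP.
rewrite lP scale1r in Pr.
have sr : size r = n by apply/eqP; rewrite -eqSS -sP Pr size_prod_XsubC.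
have rU : uniq r.
  rewrite -separable_prod_XsubC -Pr unlock; apply: Pdiv.ClosedField.root_coprimep => x /rootP Px.
  rewrite dP qb; apply/negP => /eqP/(poly_of_roots_eq0 n_neq0)[k xk].
  have := aP k; rewrite /critical_value -qb -xk => /eqP; apply.
  by apply/eqP; rewrite eq_sym -subr_eq0 -[a in _ - a](hornerC a x) -hornerN -hornerD Px.
have [z zr] : exists z : ordered_conf R n, conf_coord z =1 fun k => r`_k.
  apply: ordered_confP => i j /eqP; rewrite nth_uniq ?sr//.
  by move=> /eqP/val_inj.
have zP : poly_of_roots 1 z = P.
  rewrite /poly_of_roots scale1r Pr (big_nth 0) sr big_mkord.
  by apply: eq_bigr => k _; rewrite zr.
have pP : @RC_set R n (\pi_(conf 1 n) z).
  exists (set_val q), b, a; split => //.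
  - exact: set_valP.
  - by move=> k; rewrite line_integral0E -/Q qb; exact: aP.
  - by move=> x; rewrite conf_poly_pi zP line_integral0E hornerD hornerN hornerC.
pose p : RC R n := exist (fun p => p \in @RC_set R n) _ (mem_set pP).
have pE : conf_poly (set_val p) = P by rewrite /p set_valE /= conf_poly_pi.
exists p => //; apply: val_inj; apply: conf_poly_inj.
by rewrite [LHS]conf_poly_derivative pE dP.
Qed.

End DerivativeMap.

(** * The fibration *)

Lemma set_type_exists (T : Type) (A : set T) (x : T) :
  A x -> exists y : set_type A, set_val y = x.
Proof. by move=> Ax; exists (exist (fun x => x \in A) x (mem_set Ax)). Qed.

Section Fibration.
Variable R : realType.
Local Notation C := (R[i]^o).
Variable n : nat.
Hypothesis n_gt0 : (0 < n)%N.

Let n_neq0 : n%:R != 0 :> R[i]. Proof. by rewrite pnatr_eq0 -lt0n. Qed.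

Lemma critical_value_continuous (k : 'I_n.-1) :
  continuous (fun b : ordered_conf R n.-1 => critical_value b k : C).
Proof.
move=> b.
apply: (@cvg_horner C _ _ (nbhs_filter b) n.-1.+2
  (fun b => primitive (poly_of_roots n%:R b)) _ (fun b => conf_coord b k)).
- by move=> b'; rewrite (leq_trans (size_primitive _))// ltnS size_poly_of_roots.
- by rewrite (leq_trans (size_primitive _))// ltnS size_poly_of_roots.
- by apply: cvg_primitive; exact: cvg_poly_of_roots.
- exact: conf_coord_continuous.
Qed.

Lemma cvg_conf_primitive (q : conf n%:R n.-1) (x : R[i]) :
  (fun p : conf n%:R n.-1 => (primitive (@conf_poly R _ _ p)).[x] : C) @ q -->
  ((primitive (conf_poly q)).[x] : C).
Proof.
apply: (@cvg_horner C _ _ (nbhs_filter q) n.-1.+2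
  (fun p => primitive (@conf_poly R n%:R n.-1 p)) _ (fun=> x)).
- by move=> p; rewrite (leq_trans (size_primitive _))// ltnS size_conf_poly.
- by rewrite (leq_trans (size_primitive _))// ltnS size_conf_poly.
- by apply: cvg_primitive; exact: cvg_conf_poly.
- exact: cvg_cst.
Qed.

(** Each coefficient of the derivative is a fixed multiple of one of [P], and by [cvg_conf]
    convergence of values suffices in the target. *)
Lemma derivative_map_continuous : continuous (@derivative_map R n).
Proof.
move=> p; apply: (@cvg_set_type _ _ _ (nbhs p)); apply: (@cvg_conf R _ _ _ _ (nbhs p)) => // x.
have pP i : (fun t : RC R n => (conf_poly (set_val t))`_i : C) @ p -->
    ((conf_poly (set_val p))`_i : C).
  apply: (@continuous_comp _ _ C set_val (fun t => (conf_poly t)`_i)).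
    exact: set_val_continuous.
  exact: cvg_conf_poly.
apply: (@cvg_horner C _ _ (nbhs_filter p) n.-1.+1
  (fun t : RC R n => conf_poly (set_val (derivative_map t))) _ (fun=> x)).
- by move=> t; exact: size_conf_poly.
- exact: size_conf_poly.
- have dE (t : RC R n) i : (conf_poly (set_val (derivative_map t)))`_i =
      (conf_poly (set_val t))`_i.+1 * i.+1%:R.
    by rewrite conf_poly_derivative coef_deriv -[LHS]mulr_natr.
  move=> i; rewrite dE; under eq_fun do rewrite dE.
  by apply: cvgC_M; [exact: pP|exact: cvg_cst].
- exact: cvg_cst.
Qed.

Lemma neg_const_coef_continuous : continuous (@neg_const_coef R n : RC R n -> C).
Proof.
move=> p; apply: (@cvgC_N R _ (nbhs p)).
apply: (@continuous_comp _ _ C set_val (fun t => (conf_poly t).[0])).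
  exact: set_val_continuous.
exact: cvg_conf_horner.
Qed.

(* Its modulus exceeds that of every critical value. *)
Definition noncritical (b : ordered_conf R n.-1) : R[i] :=
  1 + \sum_k `|critical_value b k|.

Lemma noncriticalP (b : ordered_conf R n.-1) k : noncritical b != critical_value b k.
Proof.
have s0 : 0 <= \sum_(j | j != k) `|critical_value b j| by apply: sumr_ge0.
have : `|critical_value b k| < `|noncritical b|.
  rewrite [X in _ < X]ger0_norm; last by rewrite addr_ge0 ?ler01 ?sumr_ge0.
  by rewrite /noncritical (bigD1 k)//= addrCA ltrDl ltr_pwDl.
by apply: contraTneq => ->; rewrite ltxx.
Qed.

Lemma noncritical_perm (b b' : ordered_conf R n.-1) :
  \pi_(conf n%:R n.-1) b = \pi_(conf n%:R n.-1) b' -> noncritical b = noncritical b'.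
Proof.
move=> bb'; have pbb' : poly_of_roots n%:R b = poly_of_roots n%:R b'.
  by rewrite -!conf_poly_pi bb'.
have [s sb] := (conf_pi_eq b b' n_neq0).1 bb'.
rewrite /noncritical; congr (_ + _); rewrite (reindex_perm s); apply: eq_bigr => k _.
by rewrite /critical_value pbb' sb.
Qed.

Lemma noncritical_continuous : continuous (fun b => noncritical b : C).
Proof.
move=> b; apply: (@cvgC_D R _ (nbhs b)); first exact: cvg_cst.
apply: (@cvg_sum_seq C _ _ (nbhs_filter b)) => k _.
by apply: (@cvg_norm _ C); exact: critical_value_continuous.
Qed.

(** The choice of ordering made by [repr] is harmless: [noncritical] is symmetric, so it descends to
    the quotient. *)
Lemma noncritical_repr_continuous :
  continuous (fun q : conf n%:R n.-1 => noncritical (repr q) : C).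
Proof.
apply: (@repr_comp_continuous _ _ C _ noncritical_continuous) => b b' /eqP bb'.
by apply/eqP; exact: noncritical_perm.
Qed.

Lemma derivative_map_section :
  exists2 I : QC R n -> RC R n, continuous I & cancel I (@derivative_map R n).
Proof.
have ex (q : QC R n) : exists p : RC R n, derivative_map p = q /\
    conf_poly (set_val p) = primitive (conf_poly (set_val q)) - (noncritical (repr (set_val q)))%:P.
  have qE : conf_poly (set_val q) = poly_of_roots n%:R (repr (set_val q)).
    by rewrite -conf_poly_pi reprK.
  have [p pq pE] := RC_exists n_gt0 qE (noncriticalP _).
  by exists p.
have [I IP] := choice ex; exists I => [q|q]; last by have [] := IP q.
apply: (@cvg_set_type _ _ _ (nbhs q)).
apply: (@cvg_conf R _ _ _ _ (nbhs q)) => [|x]; first exact: oner_neq0.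
under eq_fun do rewrite (IP _).2 hornerD hornerN hornerC.
rewrite (IP _).2 hornerD hornerN hornerC; apply: cvgC_B.
  apply: (@continuous_comp _ _ C set_val (fun t => (primitive (conf_poly t)).[x])).
    exact: set_val_continuous.
  exact: cvg_conf_primitive.
apply: (@continuous_comp _ _ C set_val (fun t : conf (n%:R : R[i]) n.-1 => noncritical (repr t))).
  exact: set_val_continuous.
exact: noncritical_repr_continuous.
Qed.

(** Finitely many nonzero differences stay nonzero nearby, so one rotation [u] serves a whole
    neighbourhood. *)
Lemma near_separated (u : R[i]) (b : ordered_conf R n.-1) :
  injective (fun k => complex.Re (u * critical_value b k)) ->
  \forall b' \near b, injective (fun k => complex.Re (u * critical_value b' k)).
Proof.
move=> bI.
have cv k : (fun b' => complex.Re (u * critical_value b' k)) @ b -->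
    complex.Re (u * critical_value b k).
  apply: (@cvgRe R _ (nbhs b) (fun b' => u * critical_value b' k)).
  by apply: cvgC_M; [exact: cvg_cst|exact: critical_value_continuous].
have : \forall b' \near b, forall p : 'I_n.-1 * 'I_n.-1, p.1 != p.2 ->
    complex.Re (u * critical_value b' p.1) != complex.Re (u * critical_value b' p.2).
  apply: (@filter_forall _ _ _ (nbhs b) (nbhs_filter b)) => -[k j] /=.
  have [->|kj] := eqVneq k j; first by apply: nearW => b'; rewrite eqxx.
  have : \forall b' \near b,
      complex.Re (u * critical_value b' k) - complex.Re (u * critical_value b' j) != 0.
    apply: (@cvgr_neq0 _ _ _ _ (nbhs_filter b)); first exact: cvgB (@cv k) (@cv j).
    by rewrite subr_eq0 (inj_eq bI).
  by apply: filterS => b'; rewrite subr_eq0.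
apply: filterS => b' b'P k j kj; apply: contrapT => /eqP/(b'P (k, j))/eqP.
exact.
Qed.

Lemma derivative_map_locally_trivial (w : ordered_conf R n.-1) :
  locally_trivial_fibration (punctured_plane w) (@derivative_map R n).
Proof.
split; first exact: derivative_map_continuous.
move=> q0; have [z0 z0q q0E] := conf_polyE (set_val q0).
have [u u0 uI] := exists_separating (critical_value_inj n_gt0 q0E).
have [u' u'0 u'I] := exists_separating (@conf_coord_inj _ _ w).
(* Over [U] the roots are ordered continuously and [u] still separates the critical values. *)
have [U [r [oU Uz0 rP]]] := local_ordering n_neq0 (near_separated uI).
pose V : set (QC R n) := set_val @^-1` U.
pose crit (q : QC R n) := critical_value (r (set_val q)).
have critE (q : QC R n) : V q ->
    conf_poly (set_val q) = poly_of_roots n%:R (r (set_val q)).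
  by move=> /rP[_ rq _]; rewrite -conf_poly_pi rq.
have critI (q : QC R n) : V q -> injective (fun k => complex.Re (u * crit q k)).
  by move=> /rP[].
have crit_cvg (q : QC R n) k : V q -> (fun p => crit p k : C) @ q --> (crit q k : C).
  move=> /rP[_ _ rq].
  apply: (@continuous_comp _ _ C set_val (fun p => critical_value (r p) k)).
    exact: set_val_continuous.
  apply: (@continuous_comp _ _ C r (fun b => critical_value b k)) => //.
  exact: critical_value_continuous.
pose wc := conf_coord w.
(* [Phi q] is a homeomorphism of the plane that carries the critical values of [q] to the points of
   [w], passing through the points [i k]. *)
pose Phi q a := unstraighten u' wc (straighten u (crit q) a).
pose Psi q a := unstraighten u (crit q) (straighten u' wc a).
have PhiK q : cancel (Phi q) (Psi q).
  by move=> a; rewrite /Phi /Psi unstraightenK// straightenK.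
have PsiK q : cancel (Psi q) (Phi q).
  by move=> a; rewrite /Phi /Psi unstraightenK// straightenK.
have Phi_crit q k : V q -> Phi q (crit q k) = wc k.
  move=> Vq; rewrite /Phi straighten_point; last exact: critI.
  by rewrite -(straighten_point k u'I) straightenK.
exists V.
  split; last by rewrite /V /= -z0q.
  by apply: open_comp => // q _; exact: set_val_continuous.
have phi_ex (e : set_type (@derivative_map R n @^-1` V)) :
    exists y : set_type V * punctured_plane w,
      set_val y.1 = derivative_map (set_val e) /\
      set_val y.2 = Phi (derivative_map (set_val e)) (neg_const_coef (set_val e)).
  have Ve : V (derivative_map (set_val e)) by exact: (set_valP e).
  have [q qE] := set_type_exists Ve.
  have [|a aE] := @set_type_exists _ (~` range wc : set C)
      (Phi (derivative_map (set_val e)) (neg_const_coef (set_val e))).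
    (* As [Phi] is injective, hitting [w_k] would make the constant equal to the [k]th critical
       value. *)
    move=> [k _]; rewrite -(Phi_crit _ k Ve) => /(can_inj (PhiK _))/esym/eqP.
    have := neg_const_coef_noncritical n_gt0 k (critE _ Ve).
    by rewrite /crit => /negP.
  by exists (q, a).
have [phi phiP] := choice phi_ex.
(* The inverse takes [(q, a)] to the polynomial with derivative [q] and constant term
   [- Psi q a]. *)
have psi_ex (y : set_type V * punctured_plane w) :
    exists e : set_type (@derivative_map R n @^-1` V),
      derivative_map (set_val e) = set_val y.1 /\
      conf_poly (set_val (set_val e)) =
        primitive (conf_poly (set_val (set_val y.1))) - (Psi (set_val y.1) (set_val y.2))%:P.
  case: y => q a /=; have Vq : V (set_val q) by exact: (set_valP q).
  have [k|p pq pE] := RC_exists n_gt0 (critE _ Vq) (a := Psi (set_val q) (set_val a)).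
    apply/eqP => ak; have : (~` range wc) (set_val a) by exact: (set_valP a).
    by apply; exists k => //; rewrite -(Phi_crit _ k Vq) /crit -ak PsiK.
  have [|e eE] := @set_type_exists _ (@derivative_map R n @^-1` V) p.
    by rewrite /= pq.
  by exists e; rewrite eE.
have [psi psiP] := choice psi_ex.
exists phi; last by move=> e; exact: (phiP e).1.
split.
  move=> e; have Ve : V (derivative_map (set_val e)) by exact: (set_valP e).
  have De : (fun t => derivative_map (@set_val _ (@derivative_map R n @^-1` V) t)) @ e -->
      derivative_map (set_val e).
    apply: (@continuous_comp _ _ _ set_val (@derivative_map R n)).
      exact: set_val_continuous.
    exact: derivative_map_continuous.
  have phiE : phi = fun t => ((phi t).1, (phi t).2).
    by apply/funext => t; exact: surjective_pairing.
  suff : (fun t => ((phi t).1, (phi t).2)) @ e --> ((phi e).1, (phi e).2).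
    by rewrite -phiE -surjective_pairing.
  apply: (@cvg_pair _ _ _ (nbhs e) (nbhs (phi e).1) (nbhs (phi e).2)
    (nbhs_filter e) (nbhs_filter (phi e).1) (nbhs_filter (phi e).2)
    (fun t => (phi t).1) (fun t => (phi t).2));
    apply: (@cvg_set_type _ _ _ (nbhs e)).
    by under eq_fun do rewrite (phiP _).1; rewrite (phiP _).1.
  under eq_fun do rewrite (phiP _).2; rewrite (phiP _).2.
  apply: cvg_unstraighten => // [k|]; first exact: cvg_cst.
  apply: cvg_straighten => // [|k|].
  - exact: critI.
  - exact: (@cvg_comp _ _ _ _ (fun p => crit p k : C) _ _ _ De (crit_cvg _ k Ve)).
  - apply: (@continuous_comp _ _ C set_val (@neg_const_coef R n)).
      exact: set_val_continuous.
    exact: neg_const_coef_continuous.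
exists psi; split.
- move=> e; have [ph1 ph2] := phiP e; have [ps1 ps2] := psiP (phi e).
  apply: val_inj; apply: RC_inj; first by rewrite ps1 ph1.
  by rewrite (neg_const_coefE ps2) ph1 ph2 PhiK.
- move=> y; have [ps1 ps2] := psiP y; have [ph1 ph2] := phiP (psi y).
  rewrite [LHS]surjective_pairing [RHS]surjective_pairing; congr (_, _); apply: val_inj.
    by rewrite [LHS]ph1 ps1.
  by rewrite [LHS]ph2 ps1 (neg_const_coefE ps2) PsiK.
- move=> y; have Vy : V (set_val y.1) by exact: (set_valP y.1).
  have y1 : (fun t : set_type V * punctured_plane w => set_val t.1) @ y --> set_val y.1.
    apply: (@continuous_comp _ _ _ fst set_val); first exact: cvg_fst.
    exact: set_val_continuous.
  have y2 : (fun t : set_type V * punctured_plane w => set_val t.2 : C) @ y --> (set_val y.2 : C).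
    apply: (@continuous_comp _ _ _ snd set_val); first exact: cvg_snd.
    exact: set_val_continuous.
  (* Two subspaces are nested here: the preimage of [V] in [RC], and [RC] in the configuration
     space. *)
  apply: (@cvg_set_type _ _ _ (nbhs y)); apply: (@cvg_set_type _ _ _ (nbhs y)).
  apply: (@cvg_conf R _ _ _ _ (nbhs y)) => [|x]; first exact: oner_neq0.
  under eq_fun do rewrite (psiP _).2 hornerD hornerN hornerC.
  rewrite (psiP _).2 hornerD hornerN hornerC; apply: cvgC_B.
    have prim_cvg :
        (fun q : QC R n => (primitive (conf_poly (set_val q))).[x] : C) @ set_val y.1 -->
        ((primitive (conf_poly (set_val (set_val y.1)))).[x] : C).
      apply: (@continuous_comp _ _ C set_val (fun t => (primitive (conf_poly t)).[x])).
        exact: set_val_continuous.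
      exact: cvg_conf_primitive.
    exact: (@cvg_comp _ _ _ _ _ _ _ _ y1 prim_cvg).
  apply: cvg_unstraighten => [|k|].
  - exact: critI.
  - exact: (@cvg_comp _ _ _ _ (fun p => crit p k : C) _ _ _ y1 (crit_cvg _ k Vy)).
  - apply: (@cvg_straighten R _ _ (nbhs y) _ u' (fun=> wc) wc u'I _ _ _ y2) => k.
    exact: cvg_cst.
Qed.

End Fibration.

Theorem theorem1p2 (R : realType) (n : nat) (n_ge2 : (2 <= n)%N) :
  (forall w : ordered_conf R n.-1,
     locally_trivial_fibration (punctured_plane w) (@derivative_map R n)) /\
  (exists2 I : QC R n -> RC R n, continuous I & cancel I (@derivative_map R n)).
Proof.
have n_gt0 : (0 < n)%N by exact: ltnW.
split; first exact: derivative_map_locally_trivial.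
exact: derivative_map_section.
Qed.
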